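(* Let $k\ge 2$ be an integer and $\epsilon>0$. Suppose $h=h(X)$ satisfies $1\le h\le (\log X)^{k\log k-k+1-\epsilon}$. Then for every $\eta>0$, for all sufficiently large $X$, the number of integers $x\in[X,2X]$ with $$\sum_{x<n\le x+h}d_k(n)>\eta\, h(\log x)^{k-1}$$ is at most $\eta X$; that is, $\sum_{x<n\le x+h}d_k(n)=o(h(\log x)^{k-1})$ for all but $o(X)$ integers $x\in[X,2X]$.
   Context: For an integer $k\ge1$, $d_k(n)=\#\{(n_1,\dots,n_k)\in\mathbb N^k: n_1n_2\cdots n_k=n\}$ is the $k$-fold divisor function. *)

(* Defs.v *)
From HB Require Import structures.
From mathcomp Require Import all_boot all_order all_algebra.
From mathcomp Require Import all_classical all_reals exp.
Set Implicit Arguments. Unset Strict Implicit. Unset Printing Implicit Defensive.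
Import Order.TTheory GRing.Theory Num.Theory.
Local Open Scope ring_scope.

(* k-fold divisor function: number of k-tuples (n_1,...,n_k) of positive
   integers with n_1 * ... * n_k = n.  Each n_i divides n, so n_i <= n;
   for n = 0 there is no such tuple (positive entries). *)
Definition dk (k n : nat) : nat :=
  #|[set t : {ffun 'I_k -> 'I_n.+1} |
      [forall i, (0 < t i)%N] && (\prod_(i < k) (t i : nat) == n)%N]|.

Definition short_sum (R : realType) (k x : nat) (h : R) : R :=
  \sum_(n < (x + Num.truncn h).+1 | (x < n)%N && (n%:R <= x%:R + h)) (dk k n)%:R.

Definition exceptional_count (R : realType) (k : nat) (h : R -> R) (eta X : R) : nat :=
  #|[set x : 'I_(Num.truncn (2 * X)).+1 |
      [&& X <= (x : nat)%:R, (x : nat)%:R <= 2 * X &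
          eta * h X * (ln ((x : nat)%:R)) ^+ (k - 1) < short_sum k x (h X)]]|.

(* Main.v *)
Require Import Defs.
From HB Require Import structures.
From mathcomp Require Import all_boot all_order all_algebra.
From mathcomp Require Import all_classical all_reals exp.
From mathcomp Require Import sequences zify ring lra.
Import Order.TTheory GRing.Theory Num.Theory.
Local Open Scope ring_scope.

(** Put [L = ln X] and [T = L `^ (tau k ln k)] with [tau < 1] close to [1].
    Since the mean of [d_k] up to [3X] is [O(L^(k-1))], Markov's inequality bounds
    the number of [n] with [d_k(n) >= T] by [O(X L^(k-1) / T)], and
    [h <= L `^ (k ln k - k + 1 - eps)] makes this [o(X / h)]: few windows contain
    such an [n].  If [d_k(n) < T] then [k ^ omega(n) <= d_k(n)] forces
    [omega(n) < tau k ln L].  The sum of [d_k] over these [n] counts tuples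
    [(n_1, ..., n_k)] of product at most [3X] whose product has few primes; it is
    [o(X L^(k-1))], because, for the weight [1/n], almost every [n_i] has about [ln L]
    prime divisors [p] with [w < p <= y] (Turan's variance argument), while two
    coordinates share a prime above [w] with frequency [O(1/w)].  One coordinate other
    than [n_i] is left free, so that only this logarithmic density matters.
    Markov's inequality over the windows then finishes the proof. *)

(** * Sums over multiples, harmonic sums, and a Mertens-type lower bound for prime reciprocals *)

Lemma sum_multiples (V : nmodType) (F : nat -> V) (p N : nat) : (0 < p)%N ->
  \sum_(n < N.+1 | (p %| n)%N) F n = \sum_(m < (N %/ p)%N.+1) F (m * p)%N.
Proof.
move=> p0; elim: N => [|N IH].
  by rewrite div0n big_mkcond !big_ord_recl !big_ord0 /= dvdn0 mul0n.
rewrite big_mkcond big_ord_recr -big_mkcond /= IH divnS //.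
case: ifP => pN /=; last by rewrite addr0.
by rewrite add1n [RHS]big_ord_recr /= -[(N %/ p)%N]add0n -(divnK pN) divnS // pN.
Qed.

Lemma sum_pos_leq z w : (\sum_(p < z.+1) (0 < p <= w) <= w)%N.
Proof.
suff H : (\sum_(p < z.+1) (0 < p <= w) <= minn z w)%N.
  by rewrite (leq_trans H)// geq_minr.
elim: z => [|z IHz]; first by rewrite big_ord1.
by rewrite big_ord_recr /=; move: IHz; case: (leqP z.+1 w) => /=; lia.
Qed.

Section Harmonic.
Context {R : realType}.
Implicit Types (n p q w y N : nat).

(* The term [n = 0] contributes nothing, since [0^-1 = 0]. *)
Definition harm N : R := \sum_(n < N.+1) n%:R^-1.

Lemma inv_nat_ge0 n : 0 <= n%:R^-1 :> R.
Proof. by rewrite invr_ge0. Qed.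

Lemma harm_ge0 N : 0 <= harm N.
Proof. by apply: sumr_ge0 => i _; exact: inv_nat_ge0. Qed.

Lemma harmS N : harm N.+1 = harm N + N.+1%:R^-1.
Proof. by rewrite /harm big_ord_recr. Qed.

Lemma harm_mono M N : (M <= N)%N -> harm M <= harm N.
Proof.
move/subnK <-; elim: (N - M)%N => [//|d IH].
by rewrite addSn harmS (le_trans IH)// lerDl inv_nat_ge0.
Qed.

(** Passing from [N] to [N.+1] multiplies the argument of [ln] by [1 + N.+1%:R^-1], and
    [ln (1 + u) <= u]. The same inequality with [u] negative gives the upper bound [harm_le_ln]. *)
Lemma ln_le_harm N : ln N.+1%:R <= harm N.
Proof.
elim: N => [|N IH]; first by rewrite ln1 harm_ge0.
have N0 : 0 < N.+1%:R :> R by [].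
rewrite harmS.
have -> : N.+2%:R = N.+1%:R * (1 + N.+1%:R^-1) :> R.
  by rewrite mulrDr mulr1 divff ?gt_eqF// -natr1.
rewrite lnM ?posrE ?addr_gt0 ?invr_gt0//.
apply: lerD => //; apply: le_ln1Dx.
by rewrite (lt_le_trans _ (inv_nat_ge0 _))// ltrN10.
Qed.

Lemma harm_le_ln N : (0 < N)%N -> harm N <= 1 + ln N%:R.
Proof.
case: N => // N _; elim: N => [|N IH].
  by rewrite /harm !big_ord_recl big_ord0 /= ln1 invr0 invr1 add0r.
rewrite harmS; apply: (le_trans (lerD IH (lexx _))).
rewrite -addrA lerD2l.
have N0 : 0 < N.+1%:R :> R by [].
have N1 : 0 < N.+2%:R :> R by [].
have e : N.+1%:R = N.+2%:R * (1 + (- N.+2%:R^-1)) :> R.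
  by rewrite mulrDr mulr1 mulrN divff ?gt_eqF// -[N.+2%:R]natr1 addrK.
have lt1 : N.+2%:R^-1 < 1 :> R by rewrite invf_lt1// ltr1n.
rewrite {1}e lnM ?posrE ?subr_gt0// -addrA gerDl -lerBrDr sub0r.
by apply: le_ln1Dx; rewrite ltrN2.
Qed.

Lemma sum_multiples_inv p N : (0 < p)%N ->
  \sum_(n < N.+1 | (p %| n)%N) n%:R^-1 = p%:R^-1 * harm (N %/ p)%N.
Proof.
move=> p0; rewrite (sum_multiples R (fun n => n%:R^-1))// /harm mulr_sumr.
by apply: eq_bigr => m _; rewrite natrM invfM mulrC.
Qed.

Lemma sum_multiples_inv_le p N : (0 < p)%N ->
  \sum_(n < N.+1 | (p %| n)%N) n%:R^-1 <= p%:R^-1 * harm N.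
Proof.
move=> p0; rewrite sum_multiples_inv//; apply: ler_wpM2l; first exact: inv_nat_ge0.
by apply: harm_mono; rewrite leq_div.
Qed.

(** Since [N < p * (N %/ p).+1], the logarithm drops by at most [ln y]; the extra [1] is the gap
    between the two logarithmic bounds on [harm]. *)
Lemma harm_div_ge p y N : (0 < p <= y)%N -> (0 < N)%N ->
  harm N - (1 + ln y%:R) <= harm (N %/ p)%N.
Proof.
move=> /andP[p0 py] N0; have := ln_le_harm (N %/ p)%N.
have := harm_le_ln N N0.
have : ln N%:R <= ln (N %/ p)%N.+1%:R + ln y%:R :> R.
  rewrite -lnM ?posrE ?ltr0n//; last exact: leq_trans py.
  rewrite ler_ln ?posrE ?mulr_gt0 ?ltr0n//; last exact: leq_trans py.
  rewrite -natrM ler_nat (leq_trans (ltnW (ltn_ceil N p0)))//.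
  by rewrite leq_mul2l py orbT.
lra.
Qed.

(** A truncated Euler product over the primes below [j]. The term [n = 0] passes the test but has
    inverse [0]. *)
Definition smooth_harm j N : R :=
  \sum_(n < N.+1 | all (fun p => p < j)%N (primes n)) n%:R^-1.

Definition prime_recip w y : R :=
  \sum_(p < y.+1 | prime p && (w < p)%N) p%:R^-1.

Lemma smooth_harm_composite j N : ~~ prime j ->
  smooth_harm j.+1 N = smooth_harm j N.
Proof.
move=> pj; apply: eq_bigl => n; apply: eq_in_all => p.
rewrite mem_primes => /and3P[pp _ _]; rewrite ltnS leq_eqVlt.
by case: eqP => // e; rewrite -e pp in pj.
Qed.

(** One Euler factor, without a geometric series: an admissible [n] prime to [j] is counted in
    [smooth_harm j N], and [n = j * m] leaves an [m] that is again admissible. *)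
Lemma smooth_harm_prime j N : prime j ->
  smooth_harm j.+1 N <= smooth_harm j N + j%:R^-1 * smooth_harm j.+1 N.
Proof.
move=> pj; have j0 := prime_gt0 pj.
rewrite {1}/smooth_harm (bigID (fun n : 'I_N.+1 => (j %| n)%N))/= addrC.
apply: lerD.
  rewrite /smooth_harm big_mkcond [leRHS]big_mkcond; apply: ler_sum => n _ /=.
  case: ifP => [/andP[/allP sn jn]|_]; last by case: ifP => _ //; exact: inv_nat_ge0.
  have [->|n0] := posnP n; first by rewrite /= invr0.
  rewrite ifT//; apply/allP => p pn; have := sn _ pn.
  rewrite ltnS leq_eqVlt => /predU1P[e|//].
  by move: pn; rewrite mem_primes e (negPf jn) !andbF.
rewrite (eq_bigl (fun n : 'I_N.+1 =>
  (j %| n)%N && all (fun p => p < j.+1)%N (primes n))); last by move=> n; rewrite andbC.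
rewrite big_mkcondr /=.
rewrite (sum_multiples R (fun n =>
  if all (fun p => p < j.+1)%N (primes n) then n%:R^-1 else 0))//.
pose G m : R := if all (fun p => p < j.+1)%N (primes m) then m%:R^-1 else 0.
have G0 m : 0 <= G m by rewrite /G; case: ifP => // _; exact: inv_nat_ge0.
apply: (@le_trans _ _ (j%:R^-1 * \sum_(m < (N %/ j)%N.+1) G m)).
  rewrite mulr_sumr; apply: ler_sum => m _.
  have [->|m0] := posnP m; first by rewrite mul0n /G /= invr0 mulr0.
  rewrite /G; case: ifP => sm; last by rewrite mulr_ge0 ?inv_nat_ge0//; exact: G0.
  rewrite ifT ?natrM ?invfM 1?mulrC//; apply/allP => p pm.
  move/allP: sm; apply; rewrite primesM// pm //.
apply: ler_wpM2l; first exact: inv_nat_ge0.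
rewrite /smooth_harm [leRHS]big_mkcond -/(G _) /=.
rewrite -(big_mkord predT G) -(big_mkord predT (fun m => G m)).
rewrite (@big_cat_nat _ _ _ (N %/ j)%N.+1 0 N.+1)//= ?ltnS ?leq_div//.
by rewrite lerDl sumr_ge0.
Qed.

(** A prime [p] costs a factor [1 + 1/(p-1)], at most the exponential of
    [1/(p-1) = 1/p + (1/(p-1) - 1/p)]. The first summand feeds [prime_recip]; the second, allowed
    for every integer, telescopes to [1 - j.+1%:R^-1]. *)
Lemma smooth_harm_le j N :
  smooth_harm j.+2 N <= expR (prime_recip 0 j.+1 + (1 - j.+1%:R^-1)).
Proof.
elim: j => [|j IH].
  rewrite invr1 subrr addr0 (@le_trans _ _ 1)//; last first.
    rewrite -[leLHS]expR0 ler_expR sumr_ge0// => p _; exact: inv_nat_ge0.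
  rewrite /smooth_harm big_mkcond (eq_bigr (fun n : 'I_N.+1 => (n == 1%N :> nat)%:R)).
    have -> : \sum_(i < N.+1) (i == 1%N :> nat)%:R = (0 < N)%:R :> R.
      case: N => [|N]; first by rewrite big_ord1.
      rewrite big_ord_recl/= add0r big_ord_recl /= big1 ?addr0 // => i _.
    by rewrite lern1; case: N.
  move=> n _; case: (nat_of_ord n) => [|[|m]] /=; rewrite ?invr0 ?invr1 //.
  case: ifP => // /allP/(_ (pdiv m.+2)); rewrite mem_primes pdiv_prime ?pdiv_dvd//=.
  by move=> /(_ isT); rewrite ltnS leqNgt prime_gt1 ?pdiv_prime.
have [pj|pj] := boolP (prime j.+2); last first.
  rewrite smooth_harm_composite//; apply: (le_trans IH); rewrite ler_expR.
  rewrite /prime_recip [X in _ <= X + _]big_mkcond big_ord_recr /= (negPf pj) addr0 -big_mkcond/=.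
  by rewrite lerD2l lerD2l lerN2 lef_pV2 ?posrE ?ltr0n// ler_nat.
have := smooth_harm_prime j.+2 N pj; set S' := smooth_harm _ _; set S := smooth_harm _ _.
move=> SS; have a0 : 0 < j.+1%:R :> R by [].
have S'S : S' <= S * (1 + j.+1%:R^-1).
  move: SS; rewrite -[j.+2%:R]natr1; move: (j.+1%:R) a0 => a a0 SS.
  have e : (1 - (a + 1)^-1) * (1 + a^-1) = 1 by field; rewrite !gt_eqF ?addr_gt0.
  have : S' * (1 - (a + 1)^-1) <= S.
    by rewrite mulrBr mulr1 lerBlDr [S' * _]mulrC.
  move/(ler_wpM2r (_ : 0 <= 1 + a^-1)); rewrite -mulrA e mulr1; apply.
  by rewrite addr_ge0 ?invr_ge0 ?ltW.
apply: (le_trans S'S).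
rewrite /prime_recip big_mkcond big_ord_recr /= pj -big_mkcond/=.
apply: (@le_trans _ _ (expR (prime_recip 0 j.+1 + (1 - j.+1%:R^-1)) * expR (j.+1%:R^-1))).
  by apply: ler_pM => //; [apply: sumr_ge0 => i _; exact: inv_nat_ge0
    | rewrite addr_ge0 ?inv_nat_ge0 | exact: expR_ge1Dx].
rewrite -expRD ler_expR -addrA subrK -addrA lerD2l.
by rewrite [j.+2%:R^-1 + _]addrC subrK.
Qed.

Lemma harm_le_expR_prime_recip N : harm N <= expR (prime_recip 0 N + 1).
Proof.
case: N => [|N]; first by rewrite /harm big_ord1 invr0 expR_ge0.
have -> : harm N.+1 = smooth_harm N.+2 N.+1.
  rewrite /smooth_harm big_mkcond; apply: eq_bigr => n _; rewrite ifT//.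
  apply/allP => p; rewrite mem_primes => /and3P[_ n0 /(dvdn_leq n0) pn].
  exact: leq_ltn_trans pn (ltn_ord n).
apply: (le_trans (smooth_harm_le _ _)); rewrite ler_expR.
by rewrite lerD2l gerBl inv_nat_ge0.
Qed.

(** Take logarithms in [ln y.+1%:R <= harm y <= expR (prime_recip 0 y + 1)]; the primes up to [w]
    are discarded at a cost of at most [1] each. *)
Lemma prime_recip_ge w y : (0 < y)%N -> ln (ln y.+1%:R) - 1 - w%:R <= prime_recip w y.
Proof.
move=> y0.
have l0 : 0 < ln y.+1%:R :> R by rewrite ln_gt0// ltr1n.
have h : ln (ln y.+1%:R) <= prime_recip 0 y + 1.
  rewrite -ler_expR lnK ?posrE//.
  exact: le_trans (ln_le_harm _) (harm_le_expR_prime_recip _).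
suff : prime_recip 0 y <= prime_recip w y + w%:R by lra.
rewrite /prime_recip (bigID (fun p : 'I_y.+1 => (w < p)%N))/=.
apply: lerD.
  rewrite le_eqVlt; apply/orP; left; apply/eqP; apply: eq_bigl => p.
  by case pp: (prime p) => //=; rewrite prime_gt0.
apply: (@le_trans _ _ (\sum_(p < y.+1) ((0 < p <= w)%N)%:R)).
  rewrite big_mkcond; apply: ler_sum => p _.
  case: ifP => [/andP[/andP[pp p0]]|_]; last by rewrite ler0n.
  by rewrite -leqNgt => pw; rewrite p0 pw invf_le1// ?ler1n ?ltr0n.
rewrite -natr_sum ler_nat.
exact: sum_pos_leq.
Qed.

End Harmonic.

(** * Prime divisors in a range, and Turan's variance bound for the weight [1/n] *)

Definition omega (w y n : nat) : nat :=
  (\sum_(p < y.+1 | prime p && (w < p)) (p %| n))%N.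

Lemma omega_le_primes w y n : (0 < n)%N -> (omega w y n <= size (primes n))%N.
Proof.
move=> n0; rewrite /omega.
(* The primes of [n] and the range up to [y] are compared inside the common range up to
   [maxn y n]. *)
have -> : size (primes n) = #|[set p : 'I_(maxn y n).+1 | nat_of_ord p \in primes n]|.
  rewrite cardE -(size_map val); apply: perm_size; apply: uniq_perm.
  - exact: primes_uniq.
  - by rewrite map_inj_uniq ?enum_uniq//; exact: val_inj.
  move=> p; apply/idP/mapP => [pn|[q]]; last first.
    by rewrite mem_enum inE => + ->.
  have pN : (p < (maxn y n).+1)%N.
    move: pn; rewrite mem_primes => /and3P[_ _ /(dvdn_leq n0) pn].
    by rewrite ltnS leq_max pn orbT.
  by exists (Ordinal pN); rewrite // mem_enum inE.
rewrite -sum1dep_card [X in (X <= _)%N]big_mkcond [X in (_ <= X)%N]big_mkcond /=.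
pose F p := if p \in primes n then 1%N else 0%N.
rewrite -(big_mkord predT F) (@big_cat_nat _ _ _ y.+1)//=; last first.
  by rewrite ltnS leq_maxl.
rewrite big_mkord (leq_trans _ (leq_addr _ _))//; apply: leq_sum => p _.
rewrite /F mem_primes n0 /=; case: (prime p) => //=.
by case: (w < p)%N; case: (p %| n)%N.
Qed.

Section Turan.
Context {R : realType}.
Implicit Types (n p q w y N : nat).

(** Exchange the sums over [n] and [p]. The cutoff [p <= y] enters here: it makes [harm (N %/ p)]
    differ little from [harm N]. *)
Lemma omega_mean_ge w y N : (0 < N)%N ->
  prime_recip w y * (harm N - (1 + ln y%:R)) <=
    \sum_(n < N.+1) n%:R^-1 * (omega w y n)%:R :> R.
Proof.
move=> N0.
under eq_bigr do rewrite natr_sum mulr_sumr.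
rewrite exchange_big /= /prime_recip mulr_suml; apply: ler_sum => p /andP[pp _].
have p0 := prime_gt0 pp.
have -> : \sum_(n < N.+1) n%:R^-1 * (p %| n)%N%:R = p%:R^-1 * harm (N %/ p)%N :> R.
  rewrite -sum_multiples_inv// [RHS]big_mkcond; apply: eq_bigr => n _.
  by case: ifP => _; rewrite ?mulr1 ?mulr0.
by rewrite ler_wpM2l ?inv_nat_ge0// harm_div_ge// p0 /= -ltnS ltn_ord.
Qed.

(** Expanding the square gives pairs of primes. Distinct [p] and [q] both divide [n] exactly when
    [p * q] does, which gives the first term; the diagonal gives the second. *)
Lemma omega_second_moment_le w y N :
  \sum_(n < N.+1) n%:R^-1 * (omega w y n)%:R ^+ 2 <=
    prime_recip w y ^+ 2 * harm N + prime_recip w y * harm N :> R.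
Proof.
have -> : \sum_(n < N.+1) n%:R^-1 * (omega w y n)%:R ^+ 2 =
    \sum_(p < y.+1 | prime p && (w < p)%N) \sum_(q < y.+1 | prime q && (w < q)%N)
      \sum_(n < N.+1 | (p %| n)%N && (q %| n)%N) n%:R^-1 :> R.
  transitivity (\sum_(p < y.+1 | prime p && (w < p)%N)
      \sum_(q < y.+1 | prime q && (w < q)%N)
      \sum_(n < N.+1) n%:R^-1 * ((p %| n)%N%:R * (q %| n)%N%:R) : R).
    under [RHS]eq_bigr do rewrite exchange_big /=.
    rewrite [RHS]exchange_big /=; apply: eq_bigr => n _.
    rewrite natr_sum expr2 mulr_suml mulr_sumr; apply: eq_bigr => p _.
    by rewrite !mulr_sumr.
  apply: eq_bigr => p _; apply: eq_bigr => q _.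
  rewrite [RHS]big_mkcond; apply: eq_bigr => n _.
  by case: (p %| n)%N; case: (q %| n)%N; rewrite ?(mulr1,mulr0,mul0r,mul1r).
apply: (@le_trans _ _ (\sum_(p < y.+1 | prime p && (w < p)%N)
   \sum_(q < y.+1 | prime q && (w < q)%N)
   (p%:R^-1 * q%:R^-1 * harm N + (p == q)%:R * (p%:R^-1 * harm N)))).
  apply: ler_sum => p /andP[pp _]; apply: ler_sum => q /andP[pq _].
  have [->|pqn] := eqVneq p q.
    rewrite mul1r (eq_bigl (fun n : 'I_N.+1 => (q %| n)%N)); last by move=> n; rewrite andbb.
    apply: (le_trans (sum_multiples_inv_le _ _ (prime_gt0 pq))).
    by rewrite lerDr !mulr_ge0 ?inv_nat_ge0 ?harm_ge0.
  rewrite mul0r addr0 (eq_bigl (fun n : 'I_N.+1 => (p * q %| n)%N)); last first.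
    move=> n; rewrite Gauss_dvd// prime_coprime// dvdn_prime2//.
  rewrite -invfM -natrM; apply: sum_multiples_inv_le.
  by rewrite muln_gt0 !prime_gt0.
rewrite expr2 /prime_recip -mulrA !mulr_suml -big_split /=.
rewrite le_eqVlt; apply/orP; left; apply/eqP.
apply: eq_bigr => p pP; rewrite big_split /=; congr (_ + _).
  by rewrite mulr_sumr; apply: eq_bigr => q _; rewrite mulrA.
rewrite (bigD1 p)//= eqxx mul1r big1 ?addr0// => q /andP[_ /negPf].
by rewrite eq_sym => ->; rewrite mul0r.
Qed.

(** After expansion around [P] the terms [P ^+ 2 * harm N] cancel, leaving the error of the mean,
    doubled, and the diagonal of the second moment. *)
Lemma turan w y N : (0 < N)%N ->
  \sum_(n < N.+1) n%:R^-1 * (prime_recip w y - (omega w y n)%:R) ^+ 2 <=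
    2 * prime_recip w y ^+ 2 * (1 + ln y%:R) + prime_recip w y * harm N :> R.
Proof.
move=> N0; set P := prime_recip w y.
have P0 : 0 <= P by apply: sumr_ge0 => p _; exact: inv_nat_ge0.
have e (c : R) : \sum_(n < N.+1) n%:R^-1 * (c - (omega w y n)%:R) ^+ 2 =
   c ^+ 2 * harm N - 2 * c * (\sum_(n < N.+1) n%:R^-1 * (omega w y n)%:R)
   + \sum_(n < N.+1) n%:R^-1 * (omega w y n)%:R ^+ 2 :> R.
  rewrite /harm !mulr_sumr -sumrB -big_split; apply: eq_bigr => n _ /=.
  by move: (n%:R^-1) ((omega w y n)%:R : R) => a b; ring.
rewrite e; have := omega_mean_ge w y N N0; have := omega_second_moment_le w y N; rewrite -/P.
move=> h2 /(ler_wpM2l P0) h1.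
move: h2 h1; set S1 := \sum_(n < N.+1) _; set S2 := \sum_(n < N.+1) _; nra.
Qed.

(** Chebyshev's inequality: [omega w y n < t] puts [omega w y n] at distance more than [d * P] below
    [P]. *)
Lemma few_prime_factors_le w y N (d t : R) : (0 < N)%N -> 0 < d ->
  0 < prime_recip w y :> R -> t <= (1 - d) * prime_recip w y ->
  \sum_(n < N.+1 | (omega w y n)%:R < t) n%:R^-1 <=
    (2 * (1 + ln y%:R) + harm N / prime_recip w y) / d ^+ 2.
Proof.
move=> N0 d0; set P := prime_recip w y => P0 tP.
have := turan w y N N0; rewrite -/P.
set S := \sum_(n < N.+1) _ => hS.
have dP : 0 < d ^+ 2 * P ^+ 2 by rewrite mulr_gt0 ?exprn_gt0.
have hB : d ^+ 2 * P ^+ 2 * \sum_(n < N.+1 | (omega w y n)%:R < t) n%:R^-1 <= S.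
  rewrite mulr_sumr big_mkcond; apply: ler_sum => n _; case: ifP => [ot|_]; last first.
    by rewrite mulr_ge0 ?inv_nat_ge0 ?sqr_ge0.
  rewrite mulrC ler_wpM2l ?inv_nat_ge0// -exprMn ler_sqr ?nnegrE; nra.
rewrite -(ler_pM2l dP); apply: (le_trans (le_trans hB hS)).
rewrite le_eqVlt; apply/orP; left; apply/eqP; field.
by rewrite !gt_eqF.
Qed.

End Turan.

(** * The lower bound for [dk] in terms of the number of distinct primes *)

(* Each prime power exactly dividing [n] may be given to any of the [k] factors. *)
Lemma expn_primes_leq_dk k n : (0 < n)%N -> (k ^ size (primes n) <= dk k n)%N.
Proof.
move=> n0; set m := size (primes n).
pose pr (j : 'I_m) := nth 0%N (primes n) j.
have pr_in j : pr j \in primes n by rewrite mem_nth.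
have pr_prime j : prime (pr j) by move: (pr_in j); rewrite mem_primes => /and3P[].
have pr_log j : (0 < logn (pr j) n)%N by rewrite logn_gt0.
have nE : (n = \prod_(j < m) pr j ^ logn (pr j) n)%N.
  rewrite {1}(prod_prime_decomp n0) prime_decompE big_map /=.
  by rewrite (big_nth 0%N) big_mkord.
pose fac (phi : {ffun 'I_m -> 'I_k}) i :=
  (\prod_(j < m | phi j == i) pr j ^ logn (pr j) n)%N.
have facE phi : (\prod_(i < k) fac phi i = n)%N.
  by rewrite [RHS]nE (partition_big phi predT).
have fac0 phi i : (0 < fac phi i)%N.
  by apply: prodn_cond_gt0 => j _; rewrite expn_gt0 prime_gt0.
have fac_lt phi i : (fac phi i < n.+1)%N.
  by rewrite ltnS dvdn_leq// -[X in (_ %| X)%N](facE phi) (bigD1 i)//= dvdn_mulr.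
(* The factor that [pr j] divides is the one [phi] chose, so [phi] can be recovered from the tuple;
   hence [F] is injective. *)
have fac_dvd phi i j : (pr j %| fac phi i)%N = (phi j == i).
  apply/idP/idP => [|e].
    rewrite Euclid_dvd_prod// big_has_cond => /hasP[l _ /andP[/eqP <-]].
    rewrite Euclid_dvdX// => /andP[]; rewrite dvdn_prime2// => e _.
    suff -> : j = l by [].
    by apply/val_inj/eqP; rewrite -(nth_uniq 0%N (ltn_ord j) (ltn_ord l) (primes_uniq n)).
  by rewrite /fac (bigD1 j)//= dvdn_mulr// dvdn_exp.
pose F phi : {ffun 'I_k -> 'I_n.+1} := [ffun i => Ordinal (fac_lt phi i)].
have F_inj : injective F.
  move=> f g fg; apply/ffunP => j; apply/eqP.
  rewrite eq_sym -fac_dvd; move/ffunP: fg => /(_ (f j)).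
  by rewrite !ffunE => /(congr1 val)/= <-; rewrite fac_dvd.
have -> : (k ^ m)%N = #|{ffun 'I_m -> 'I_k}| by rewrite card_ffun !card_ord.
rewrite -(card_imset _ F_inj); apply: subset_leq_card; apply/fintype.subsetP => _ /imsetP[phi _ ->].
rewrite inE; apply/andP; split; first by apply/forallP => i; rewrite ffunE /= fac0.
by rewrite -[X in _ == X](facE phi); apply/eqP/eq_bigr => i _; rewrite ffunE.
Qed.

(** * Sums of [dk] as counts of tuples *)

(** The tuples are sorted by their product; those counted by [dk k n] embed in the fibre over [n]
    once their entries are widened to the common bound [N]. *)
Lemma sum_dk_leq_card k N (Q : pred nat) :
  (\sum_(n < N.+1 | Q n) dk k n <=
   #|[set t : {ffun 'I_k -> 'I_N.+1} | [&& [forall i, (0 < t i)%N],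
        (\prod_i t i <= N)%N & Q (\prod_i t i)%N]]|)%N.
Proof.
rewrite -sum1dep_card.
rewrite (partition_big (fun t : {ffun 'I_k -> 'I_N.+1} => inord (\prod_i t i)%N : 'I_N.+1)
  (fun n : 'I_N.+1 => Q n)) /=; last first.
  by move=> t /and3P[_ tN Qt]; rewrite inordK.
apply: leq_sum => n Qn; rewrite sum1dep_card.
have nN : (n.+1 <= N.+1)%N by exact: ltn_ord.
pose F (t : {ffun 'I_k -> 'I_n.+1}) : {ffun 'I_k -> 'I_N.+1} :=
  [ffun i => widen_ord nN (t i)].
have F_inj : injective F.
  move=> f g /ffunP fg; apply/ffunP => i; have := fg i; rewrite !ffunE.
  by move/(congr1 val) => /= e; exact: val_inj.
rewrite /dk -(card_imset _ F_inj); apply: subset_leq_card.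
apply/fintype.subsetP => _ /imsetP[t + ->]; rewrite !inE => /andP[/forallP t0 /eqP tn].
have e : (\prod_i F t i = n)%N by rewrite -[RHS]tn; apply: eq_bigr => i _; rewrite ffunE.
rewrite e Qn -ltnS ltn_ord !andbT inord_val eqxx andbT.
by apply/forallP => i; rewrite ffunE /= t0.
Qed.

Lemma card_multiples_leq q c N : (0 < q)%N -> (0 < c)%N ->
  (#|[set m : 'I_N.+1 | [&& 0 < m, q %| m & m * c <= N]]| <= N %/ (q * c))%N.
Proof.
move=> q0 c0; rewrite -sum1dep_card.
rewrite (eq_bigl (fun m : 'I_N.+1 => (q %| m) && ((0 < m) && (m * c <= N)))%N); last first.
  by move=> m; rewrite andbCA.
rewrite big_mkcondr /=.
rewrite (sum_multiples nat (fun m => if (0 < m) && (m * c <= N) then 1 else 0)%N)//.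
apply: leq_trans (sum_pos_leq (N %/ q) _); apply: leq_sum => m _.
by rewrite muln_gt0 q0 andbT -mulnA leq_divRL ?muln_gt0 ?q0//; case: ifP.
Qed.

Section Tuples.
Context {R : realType}.

(* Given the other coordinates, the [j]-th one runs over the multiples of [q]
   up to [N / \prod_(i != j) t i]. *)
Lemma tuple_sum_le (k N q : nat) (j : 'I_k) (a : 'I_k -> nat -> R) :
  (0 < q)%N -> (forall i n, 0 <= a i n) ->
  \sum_(t : {ffun 'I_k -> 'I_N.+1} |
      [&& [forall i, (0 < t i)%N], (\prod_i t i <= N)%N & (q %| t j)%N])
    \prod_(i | i != j) a i (t i)
  <= N%:R / q%:R * \prod_(i | i != j) \sum_(n < N.+1) a i n / n%:R.
Proof.
move=> q0 a0.
(* Erasing the [j]-th coordinate groups the tuples into fibres, each with the remaining coordinates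
   fixed. *)
pose reset (t : {ffun 'I_k -> 'I_N.+1}) : {ffun 'I_k -> 'I_N.+1} :=
  [ffun i => if i == j then ord0 else t i].
rewrite (partition_big reset (fun s => s j == ord0)) /=; last first.
  by move=> t _; rewrite ffunE eqxx.
(* At [j] the factor is the indicator of [0], of total sum [1], so distributing the full product
   leaves exactly the [s] with [s j = ord0]. *)
pose F i (n : 'I_N.+1) : R := if i == j then (n == ord0)%:R else a i n / n%:R.
have -> : \prod_(i | i != j) \sum_(n < N.+1) a i n / n%:R =
    \sum_(s : {ffun 'I_k -> 'I_N.+1} | s j == ord0) \prod_(i | i != j) (a i (s i) / (s i)%:R).
  transitivity (\prod_i \sum_n F i n).
    have Fj : \sum_n F j n = 1.
      rewrite /F eqxx (bigD1 ord0)//= big1 ?addr0// => n /negPf ->//.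
    rewrite [RHS](bigD1 j)//= Fj mul1r.
    by apply: eq_bigr => i /negPf ij; apply: eq_bigr => n _; rewrite /F ij.
  rewrite bigA_distr_bigA [RHS]big_mkcond /=; apply: eq_bigr => s _.
  rewrite (bigD1 j)//= {1}/F eqxx; case: ifP => _; last by rewrite mul0r.
  by rewrite mul1r; apply: eq_bigr => i /negPf ij; rewrite /F ij.
rewrite mulr_sumr; apply: ler_sum => s /eqP sj.
pose A := [pred t : {ffun 'I_k -> 'I_N.+1} |
  [&& [forall i, (0 < t i)%N], (\prod_i t i <= N)%N & (q %| t j)%N] && (reset t == s)].
rewrite (eq_bigl A)//.
have As t : A t -> forall i, i != j -> t i = s i.
  by move=> /andP[_ /eqP/ffunP ts] i /negPf ij; rewrite -ts ffunE ij.
rewrite [leLHS](eq_bigr (fun=> \prod_(i | i != j) a i (s i))); last first.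
  by move=> t At; apply: eq_bigr => i ij; rewrite (As t).
rewrite sumr_const big_split /= -[leLHS]mulr_natr [leRHS]mulrCA; apply: ler_wpM2l.
  by apply: prodr_ge0 => i _.
(* An empty fibre is set aside: there [s] may vanish at some [i != j], while a member of the fibre
   guarantees [0 < c]. *)
have [/pred0P A0|] := boolP (pred0b A).
  rewrite (eq_card A0) card0 mulr_ge0 ?divr_ge0// prodr_ge0// => i _.
  exact: inv_nat_ge0.
case/pred0Pn => t0 At0.
pose c := (\prod_(i | i != j) s i)%N.
have c0 : (0 < c)%N.
  apply: prodn_cond_gt0 => i ij; rewrite -(As _ At0)//.
  by case/andP: At0 => /and3P[/forallP].
have cardA : (#|A| <= N %/ (q * c))%N.
  apply: leq_trans (card_multiples_leq q c N q0 c0).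
  rewrite -(card_in_imset (f := fun t : {ffun 'I_k -> 'I_N.+1} => t j) (D := A)); last first.
    move=> t t' At At' tt'; apply/ffunP => i; have [->//|ij] := eqVneq i j.
    by rewrite (As t)// (As t').
  apply: subset_leq_card; apply/fintype.subsetP => _ /imsetP[t At ->]; rewrite inE.
  have /andP[/and3P[/forallP tp tN ->] _] := At; rewrite tp /=.
  apply: leq_trans tN; rewrite [X in (_ <= X)%N](bigD1 j)//= leq_mul2l.
  apply/orP; right; rewrite leq_eqVlt; apply/orP; left; apply/eqP.
  by apply: eq_bigr => i ij; rewrite (As t).
have -> : \prod_(i | i != j) ((s i)%:R^-1 : R) = c%:R^-1.
  by rewrite /c natr_prod prodfV.
rewrite -mulrA -invfM -natrM ler_pdivlMr ?ltr0n ?muln_gt0 ?q0//.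
rewrite -natrM ler_nat (leq_trans _ (leq_divM N (q * c)%N))//.
by rewrite leq_mul2r cardA orbT.
Qed.

Lemma sum_ord_le k (F : 'I_k -> R) (c : R) :
  (forall i, F i <= c) -> \sum_i F i <= k%:R * c.
Proof.
move=> Fc; apply: le_trans (ler_sum _ (fun i _ => Fc i)) _.
by rewrite sumr_const card_ord mulr_natl.
Qed.

Lemma sum_dk_le k N : \sum_(n < N.+1) (dk k.+1 n)%:R <= N%:R * harm N ^+ k :> R.
Proof.
rewrite -natr_sum.
have := sum_dk_leq_card k.+1 N predT; rewrite -(ler_nat R) => /le_trans; apply.
have := @tuple_sum_le k.+1 N 1 ord0 (fun _ _ => 1) isT (fun _ _ => ler01).
rewrite divr1.
under [X in X <= _ -> _]eq_bigr do rewrite prodr_const expr1n.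
under [X in _ * X]eq_bigr do under eq_bigr do rewrite div1r.
rewrite prodr_const cardC1 card_ord /= -/(harm N).
rewrite [X in X <= _ -> _]sumr_const; apply: le_trans; rewrite ler_nat.
apply: subset_leq_card; apply/fintype.subsetP => t.
by rewrite inE unfold_in => /and3P[-> -> _]; rewrite dvd1n.
Qed.

(** [tuple_sum_le] with [j] free: the weight is the indicator of [b] at [i] and [1] at the other [k]
    coordinates, each giving a factor [harm N]. *)
Lemma sum_tuple_coord_le k N q (i j : 'I_k.+2) (b : pred nat) : (0 < q)%N -> i != j ->
  \sum_(t : {ffun 'I_k.+2 -> 'I_N.+1} | [forall i, (0 < t i)%N] && (\prod_i t i <= N)%N)
    ((q %| t j)%N && b (t i))%:R
  <= N%:R / q%:R * (harm N ^+ k * \sum_(n < N.+1 | b n) n%:R^-1) :> R.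
Proof.
move=> q0 ij.
pose a (l : 'I_k.+2) n : R := if l == i then (b n)%:R else 1.
have a0 l n : 0 <= a l n by rewrite /a; case: ifP.
have := @tuple_sum_le _ N q j a q0 a0.
rewrite [X in _ <= _ * X -> _](bigD1 i)//=.
rewrite [X in _ <= _ * (_ * X) -> _](eq_bigr (fun=> harm N)); last first.
  by move=> l /andP[_ /negPf li]; apply: eq_bigr => n _; rewrite /a li div1r.
rewrite prodr_const (_ : #|_| = k); last first.
  have := cardC [set i; j]; rewrite cards2 ij card_ord => /eqP; rewrite eqn_add2l => /eqP e.
  by rewrite -[RHS]e; apply: eq_card => l; rewrite !inE negb_or andbC.
rewrite [X in _ * (X * _)](_ : _ = \sum_(n < N.+1 | b n) n%:R^-1); last first.
  rewrite [RHS]big_mkcond; apply: eq_bigr => n _; rewrite /a eqxx.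
  by case: (b n); rewrite ?mul1r ?mul0r.
rewrite [X in _ * X]mulrC; apply: le_trans.
rewrite [leRHS](eq_bigl (fun t : {ffun 'I_k.+2 -> 'I_N.+1} =>
  ([forall i, (0 < t i)%N] && (\prod_i t i <= N)%N) && (q %| t j)%N)); last first.
  by move=> t; rewrite andbA.
rewrite [leRHS]big_mkcondr; apply: ler_sum => t _.
case: (q %| t j)%N => //=; rewrite (bigD1 i)//= {1}/a eqxx big1 ?mulr1//.
by move=> l /andP[_ /negPf li]; rewrite /a li.
Qed.

Lemma sum_inv_sqr_le w y : (0 < w)%N ->
  \sum_(p < y.+1 | prime p && (w < p)%N) p%:R^-1 ^+ 2 <= w%:R^-1 :> R.
Proof.
move=> w0.
(* Telescoping over all integers, by [1/n^2 <= 1/(n-1) - 1/n]; the sum is empty when [y < w]. *)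
suff H : \sum_(p < y.+1 | prime p && (w < p)%N) p%:R^-1 ^+ 2
    <= (if (w <= y)%N then w%:R^-1 - y%:R^-1 else 0) :> R.
  apply: (le_trans H); case: ifP => _; last exact: inv_nat_ge0.
  by rewrite gerBl inv_nat_ge0.
elim: y => [|y IH].
  by rewrite big_mkcond big_ord1 /= leqn0 (gtn_eqF w0).
rewrite big_mkcond big_ord_recr -big_mkcond /=; apply: (le_trans (lerD IH (lexx _))).
have [wy|yw] := leqP w y; last first.
  rewrite (_ : (w < y.+1)%N = false) ?andbF ?addr0; last by rewrite ltnS leqNgt yw.
  case: ifP => // wy; rewrite subr_ge0 lef_pV2 ?posrE ?ltr0n// ler_nat//.
have y0 : 0 < y%:R :> R by rewrite ltr0n; exact: leq_trans wy.
rewrite (leqW wy) -addrA lerD2l.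
apply: (@le_trans _ _ (- y%:R^-1 + y.+1%:R^-1 ^+ 2)).
  by rewrite lerD2l; case: ifP => // _; rewrite exprn_ge0 ?inv_nat_ge0.
rewrite -natr1; move: (y%:R : R) y0 => a a0.
have a1 : 0 < a + 1 by rewrite addr_gt0.
rewrite -subr_ge0.
have -> : - (a + 1)^-1 - (- a^-1 + (a + 1)^-1 ^+ 2) = a^-1 * (a + 1)^-1 ^+ 2.
  by field; rewrite !gt_eqF.
by rewrite mulr_ge0 ?exprn_ge0 ?invr_ge0 ?ltW.
Qed.

(** A union bound. If every coordinate had at least [th] primes in range and no two shared one, all
    these primes would be distinct divisors of the product, giving it at least [k * th] primes. *)
Lemma few_primes_tuple k N w y (t : {ffun 'I_k -> 'I_N.+1}) (th : R) :
  [forall i, (0 < t i)%N] -> (size (primes (\prod_i t i)%N))%:R < k%:R * th ->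
  1 <= \sum_i ((omega w y (t i))%:R < th)%R%:R +
       \sum_i \sum_(j | i != j) \sum_(p < y.+1 | prime p && (w < p)%N)
         ((p %| t j)%N && (p %| t i)%N)%:R :> R.
Proof.
move=> /forallP t0 few.
have pos1 : 0 <= \sum_i ((omega w y (t i))%:R < th)%R%:R :> R by exact: sumr_ge0.
have pos3 i j : 0 <= \sum_(p < y.+1 | prime p && (w < p)%N)
         ((p %| t j)%N && (p %| t i)%N)%:R :> R by exact: sumr_ge0.
have pos2 i : 0 <= \sum_(j | i != j) \sum_(p < y.+1 | prime p && (w < p)%N)
         ((p %| t j)%N && (p %| t i)%N)%:R :> R by exact: sumr_ge0.
have [/existsP[i oi]|/existsPn no] := boolP [exists i, (omega w y (t i))%:R < th].
  by rewrite (bigD1 i)//= oi -!addrA lerDl !addr_ge0// ?sumr_ge0.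
have [/existsP[i /existsP[j /existsP[p /and3P[ij pP pij]]]]|noc] :=
   boolP [exists i, exists j, exists p : 'I_y.+1,
     [&& i != j, prime p && (w < p)%N & (p %| t j)%N && (p %| t i)%N]].
  rewrite [X in _ + X](bigD1 i)//= [X in _ + (X + _)](bigD1 j)//=.
  rewrite [X in _ + (X + _ + _)](bigD1 p)//= pij.
  by rewrite [X in _ <= X]addrC -!addrA lerDl !addr_ge0// ?sumr_ge0//.
exfalso; move: few; rewrite ltNge => /negP; apply.
apply: (@le_trans _ _ (\sum_i (omega w y (t i)))%N%:R).
  rewrite natr_sum mulr_natl -[k in th *+ k]card_ord -sumr_const; apply: ler_sum => i _.
  by rewrite leNgt no.
rewrite ler_nat; apply: leq_trans (omega_le_primes w y _ _); last first.
  exact: prodn_gt0.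
rewrite /omega exchange_big /=; apply: leq_sum => p pP.
have [/existsP[i pi]|/existsPn np] := boolP [exists i, (p %| t i)%N].
  rewrite (bigD1 i)//= pi big1 => [|j ji].
    by rewrite (bigD1 i)//= dvdn_mulr.
  case pj: (p %| t j)%N => //; case/negP: noc; apply/existsP; exists i.
  by apply/existsP; exists j; apply/existsP; exists p; rewrite eq_sym ji pP pi pj.
by rewrite big1// => i _; rewrite (negPf (np i)).
Qed.

(** Sum the union bound over tuples. For a poor coordinate [i] some other [j] is left free; for a
    shared prime [p] both coordinates contribute [1/p], and the sum of [1/p^2] over [p > w] is at
    most [1/w]. *)
Lemma sum_dk_few_primes_le k N w y (th : R) : (0 < w)%N ->
  \sum_(n < N.+1 | (size (primes n))%:R < k.+2%:R * th) (dk k.+2 n)%:R <=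
  k.+2%:R * (N%:R * (harm N ^+ k * \sum_(n < N.+1 | (omega w y n)%:R < th) n%:R^-1)) +
  k.+2%:R ^+ 2 * (N%:R * harm N ^+ k.+1 * w%:R^-1) :> R.
Proof.
move=> w0; rewrite -natr_sum.
have := sum_dk_leq_card k.+2 N (fun n => (size (primes n))%:R < k.+2%:R * th).
rewrite -(ler_nat R) => /le_trans; apply.
pose A := [pred t : {ffun 'I_k.+2 -> 'I_N.+1} | [forall i, (0 < t i)%N] && (\prod_i t i <= N)%N].
rewrite -sum1dep_card natr_sum.
apply: (@le_trans _ _ (\sum_(t | A t) (\sum_i ((omega w y (t i))%:R < th)%R%:R +
       \sum_i \sum_(j | i != j) \sum_(p < y.+1 | prime p && (w < p)%N)
         ((p %| t j)%N && (p %| t i)%N)%:R))).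
  rewrite big_mkcond [leRHS]big_mkcond; apply: ler_sum => t _ /=.
  case: ifP => [/and3P[t0 tN few]|_]; first by rewrite t0 tN /=; exact: few_primes_tuple.
  case: ifP => // _; rewrite addr_ge0// ?sumr_ge0// => i _; rewrite sumr_ge0// => j _.
  by rewrite sumr_ge0.
rewrite big_split /=; apply: lerD.
  rewrite exchange_big /=; apply: sum_ord_le => i.
  have [j ij] : exists j : 'I_k.+2, i != j.
    by exists (if i == ord0 then ord_max else ord0); case: ifP => [/eqP ->|->].
  have := sum_tuple_coord_le k N 1 i j (fun n => (omega w y n)%:R < th) isT ij.
  rewrite divr1; apply: le_trans; apply: ler_sum => t _.
  by rewrite dvd1n.
rewrite exchange_big /= expr2 -mulrA; apply: sum_ord_le => i.
rewrite exchange_big /= big_mkcond; apply: sum_ord_le => j.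
case: ifP => ij; last by rewrite !mulr_ge0 ?exprn_ge0 ?harm_ge0 ?inv_nat_ge0.
rewrite exchange_big /=.
apply: (@le_trans _ _ (\sum_(p < y.+1 | prime p && (w < p)%N)
   N%:R * harm N ^+ k.+1 * p%:R^-1 ^+ 2)); last first.
  rewrite -mulr_sumr ler_wpM2l ?sum_inv_sqr_le// mulr_ge0 ?exprn_ge0 ?harm_ge0//.
apply: ler_sum => p /andP[pp _]; have p0 := prime_gt0 pp.
apply: (le_trans (sum_tuple_coord_le k N p i j (fun n => (p %| n)%N) p0 ij)).
have := ler_wpM2l (ler0n R N) (ler_wpM2l (exprn_ge0 k (harm_ge0 N))
  (ler_wpM2l (inv_nat_ge0 p) (sum_multiples_inv_le p N p0))).
move: (p%:R^-1) (harm N) (\sum_(_ < _ | _) _) => a H S.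
by rewrite exprSr; move: (H ^+ k) => Hk; nra.
Qed.

End Tuples.

(** * Choice of parameters for integers with few prime factors *)

Section Asymptotics.
Context {R : realType}.

Lemma powR_ge_ln (x a : R) : 0 < x -> a * ln x <= x `^ a.
Proof.
move=> x0; rewrite /powR gt_eqF//; apply: le_trans (expR_ge1Dx _).
by rewrite lerDr.
Qed.

Lemma powR_le_expR (x c : R) : 4 * c ^+ 2 + 1 <= x -> x `^ c <= expR x.
Proof.
move=> cx; have c2 := sqr_ge0 c; have x0 : 0 < x by lra.
(* With [s] the square root, [c * ln x = 2 * c * ln s <= 2 *]|c| * s <= s ^+
   2[; the threshold on]x[ensures]2 * [|c| <= s]. *)
rewrite /powR gt_eqF// ler_expR; set s := Num.sqrt x.
have s0 : 0 < s by rewrite sqrtr_gt0.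
have xs : x = s ^+ 2 by rewrite sqr_sqrtr// ltW.
have lns : ln s <= s.
  have := @le_ln1Dx R (s - 1); rewrite subrKC; lra.
have lns0 : 0 <= ln s by rewrite ln_ge0//; nra.
rewrite xs lnXn// -mulr_natr.
have cs : 2 * `|c| <= s.
  rewrite -ler_sqr; [|by rewrite nnegrE mulr_ge0|by rewrite nnegrE ltW].
  by rewrite exprMn -xs real_normK ?num_real//; lra.
apply: (@le_trans _ _ (`|c| * (ln s * 2))).
  by rewrite ler_wpM2r ?mulr_ge0// ler_norm.
have := normr_ge0 c; nra.
Qed.

Lemma sum_dk_few_primes_small k (tau eta : R) : 0 < tau < 1 -> 0 < eta ->
  exists L0 : R, forall (L : R) (N : nat), L0 <= L -> (0 < N)%N -> harm N <= 2 * L ->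
    \sum_(n < N.+1 | (size (primes n))%:R < k.+2%:R * (tau * ln L)) (dk k.+2 n)%:R
      <= eta * (N%:R * L ^+ k.+1).
Proof.
move=> /andP[tau0 tau1] eta0.
have [d [d0 d1 tauE]] : exists d, [/\ 0 < d, d < 2^-1 & tau = 1 - 2 * d].
  by exists ((1 - tau) / 2); split; lra.
(* [A / K] will bound the poor-coordinate part and [B / w] the shared-prime part; [K] and [w] make
   each at most [eta / 2]. *)
pose A : R := k.+2%:R * 2 ^+ k * 8 / d ^+ 2.
pose B : R := k.+2%:R ^+ 2 * 2 ^+ k.+1.
have A0 : 0 < A by rewrite /A divr_gt0 ?mulr_gt0 ?exprn_gt0.
have B0 : 0 < B by apply: mulr_gt0; apply: exprn_gt0; rewrite ltr0n.
pose K := 2 * A / eta.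
have K0 : 0 < K by apply: divr_gt0 => //; apply: mulr_gt0.
pose w := (Num.truncn (2 * B / eta)).+1.
have Bw : B / w%:R <= eta / 2.
  have : 2 * B / eta < w%:R by apply: truncnS_gt.
  rewrite ltr_pdivrMr// => h; rewrite ler_pdivrMr ?ltr0n//; lra.
(* Beyond this size of [ln L], the quantity [d / 2 * ln L] absorbs the loss [1 + w] of
   [prime_recip_ge] and also exceeds [K]. *)
pose M := 2 * (K + 1 + w%:R) / d.
have w0 : 0 < w%:R :> R by rewrite ltr0n.
exists (expR M) => L N ML N0 HL.
have L0 : 0 < L by apply: lt_le_trans ML; exact: expR_gt0.
have lnL : M <= ln L by rewrite -ler_expR lnK.
have dlnL : K + 1 + w%:R <= d / 2 * ln L.
  move: lnL; rewrite /M ler_pdivrMr//; lra.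
have lnL0 : 0 < ln L.
  have : 0 < d / 2 * ln L by apply: lt_le_trans dlnL; rewrite !addr_gt0.
  by rewrite pmulr_rgt0// divr_gt0.
have KlnL : K <= ln L by nra.
have KL : K <= L.
  apply: (le_trans KlnL); have := @le_ln1Dx R (L - 1); rewrite subrKC; lra.
(* With [y] about [expR E], [ln y] is negligible against [L], yet [ln (ln y)] is still about
   [(1 - d / 2) * ln L]. *)
pose E := L `^ (1 - d / 2).
have E0 : 0 < E by exact: powR_gt0.
have EK : E * K <= L.
  have e : L = E * L `^ (d / 2).
    by rewrite /E -powRD ?subrK ?powRr1 ?ltW// gt_eqF ?implybT.
  rewrite [leRHS]e ler_wpM2l ?(ltW E0)//.
  by apply: le_trans (powR_ge_ln _ _ L0); move: dlnL w0; lra.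
pose y := Num.truncn (expR E).
have y0 : (0 < y)%N by rewrite truncn_gt0 -[leLHS]expR0 ler_expR ltW.
have lny : ln y%:R <= E.
  rewrite -[leRHS]expRK ler_ln ?posrE ?expR_gt0 ?ltr0n//.
  by rewrite truncn_le expR_ge0.
have lny1 : E <= ln y.+1%:R.
  rewrite -[leLHS]expRK ler_ln ?posrE ?expR_gt0 ?ltr0n//.
  by rewrite ltW// truncnS_gt.
have P1 : (1 - d) * ln L <= prime_recip w y :> R.
  have h := @prime_recip_ge R w y y0.
  have : (1 - d / 2) * ln L <= ln (ln y.+1%:R).
    by rewrite -ln_powR ler_ln ?posrE ?powR_gt0//; exact: lt_le_trans lny1.
  move: h dlnL K0; lra.
have P2 : ln L / 2 <= prime_recip w y :> R by nra.
have P0 : 0 < prime_recip w y :> R by lra.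
(* This uses [1 - 2 * d <= (1 - d) ^+ 2]. *)
have tP : tau * ln L <= (1 - d) * prime_recip w y.
  rewrite tauE; have := ler_wpM2l (_ : 0 <= 1 - d) P1; nra.
have := few_prime_factors_le w y N d (tau * ln L) N0 d0 P0 tP.
set Bad := (X in X <= _ -> _) => badle.
(* After multiplication by [K], each of [2 * (1 + ln y)] and [harm N / prime_recip w y] is at most
   [4 * L]. *)
have badL : Bad <= 8 / (K * d ^+ 2) * L.
  apply: (le_trans badle); rewrite ler_pdivrMr ?exprn_gt0//.
  have -> : 8 / (K * d ^+ 2) * L * d ^+ 2 = 8 * L / K by field; rewrite !gt_eqF.
  rewrite ler_pdivlMr//.
  have : harm N / prime_recip w y * K <= 4 * L.
    rewrite mulrAC ler_pdivrMr//.
    have := harm_ge0 (R := R) N; nra.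
  rewrite mulrDl; nra.
apply: (le_trans (sum_dk_few_primes_le k N w y (tau * ln L) isT)).
rewrite -/Bad.
have Hk m : harm N ^+ m <= 2 ^+ m * L ^+ m.
  by rewrite -exprMn lerXn2r ?nnegrE ?harm_ge0// (le_trans (harm_ge0 N)).
have Bad0 : 0 <= Bad by apply: sumr_ge0 => n _; exact: inv_nat_ge0.
have t1 : k.+2%:R * (N%:R * (harm N ^+ k * Bad)) <= eta / 2 * (N%:R * L ^+ k.+1).
  have h : harm N ^+ k * Bad <= 2 ^+ k * L ^+ k * (8 / (K * d ^+ 2) * L).
    by apply: ler_pM => //; rewrite exprn_ge0 ?harm_ge0.
  apply: (le_trans (ler_wpM2l (ler0n _ _) (ler_wpM2l (ler0n _ _) h))).
  rewrite le_eqVlt; apply/orP; left; apply/eqP.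
  have a0 : 0 < 2 ^+ k :> R by exact: exprn_gt0.
  have b0 : 0 < k.+2%:R :> R by [].
  rewrite /K /A [L ^+ k.+1]exprS; move: (2 ^+ k) (k.+2%:R : R) (L ^+ k) a0 b0 => a b l a0 b0.
  by field; rewrite !gt_eqF.
have t2 : k.+2%:R ^+ 2 * (N%:R * harm N ^+ k.+1 * w%:R^-1) <= eta / 2 * (N%:R * L ^+ k.+1).
  have -> : k.+2%:R ^+ 2 * (N%:R * harm N ^+ k.+1 * w%:R^-1) =
     N%:R * (k.+2%:R ^+ 2 / w%:R * harm N ^+ k.+1) :> R.
    by move: (w%:R^-1) (k.+2%:R ^+ 2) (harm N ^+ k.+1) => a b c; ring.
  rewrite [leRHS]mulrCA ler_wpM2l//.
  apply: (@le_trans _ _ (k.+2%:R ^+ 2 / w%:R * (2 ^+ k.+1 * L ^+ k.+1))).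
    by rewrite ler_wpM2l// divr_ge0// exprn_ge0.
  by rewrite mulrA ler_wpM2r ?exprn_ge0 ?(ltW L0)// mulrAC.
lra.
Qed.

End Asymptotics.

(** * From exceptional windows to sums of [dk] *)

Section Count.
Context {R : realType}.

Lemma short_sum_le k x (h : R) :
  short_sum k x h <= \sum_(i < Num.truncn h) (dk k (i + x.+1))%:R.
Proof.
rewrite /short_sum.
apply: (@le_trans _ _ (\sum_(n < (x + Num.truncn h).+1 | (x < n)%N) (dk k n)%:R)).
  rewrite big_mkcond [leRHS]big_mkcond; apply: ler_sum => n _.
  by case: (x < n)%N => //=; case: ifP.
have := big_geq_mkord x.+1 (x + Num.truncn h).+1 predT (fun n => (dk k n)%:R : R).
move=> /= <-; rewrite -{1}[x.+1]add0n big_addn subSS addKn big_mkord.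
exact: lexx.
Qed.

(** For each offset [i], the points [i + x.+1] are distinct and at most [N], so each of the [r]
    offsets contributes at most the full sum. *)
Lemma window_sum_le (g : nat -> R) m r N : (forall n, 0 <= g n) -> (m + r <= N)%N ->
  \sum_(x < m.+1) \sum_(i < r) g (i + x.+1)%N <= r%:R * \sum_(n < N.+1) g n.
Proof.
move=> g0 mN; rewrite exchange_big /=; apply: sum_ord_le => i.
under eq_bigr do rewrite addnS -addSn addnC.
rewrite -(big_mkord predT (fun x => g (x + i.+1)%N)) -(big_mkord predT g).
have -> : \sum_(0 <= x < m.+1) g (x + i.+1)%N = \sum_(i.+1 <= n < m.+1 + i.+1) g n.
  by rewrite -{2}[i.+1]add0n big_addn addnK.
have iN : (m.+1 + i.+1 <= N.+1)%N by have := ltn_ord i; lia.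
rewrite (@big_cat_nat _ _ _ i.+1 0 N.+1)//=; last by lia.
rewrite (@big_cat_nat _ _ _ (m.+1 + i.+1) i.+1 N.+1)//=; last by lia.
by rewrite addrCA lerDl addr_ge0// sumr_ge0.
Qed.

(* Charge [n] with [dk k n / T] if [T <= dk k n] and with
   [dk k n / (eta * h X * ln X ^+ (k - 1))] otherwise: the window of an exceptional
   [x] then receives a total charge of at least [1]. *)
Lemma exceptional_count_le k (h : R -> R) (eta X T : R) (few : pred nat) N :
  0 < eta -> 1 < X -> 1 <= h X -> h X <= X -> 0 < T -> N = Num.truncn (3 * X) ->
  (forall n, (dk k n)%:R < T -> few n) ->
  (exceptional_count k h eta X)%:R <=
    h X / T * \sum_(n < N.+1) (dk k n)%:R +
    (eta * ln X ^+ (k - 1))^-1 * \sum_(n < N.+1 | few n) (dk k n)%:R.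
Proof.
move=> eta0 X1 h1 hX T0 NE fewP.
have lnX0 : 0 < ln X by rewrite ln_gt0.
have h0 : 0 < h X by apply: lt_le_trans h1.
set r := Num.truncn (h X).
have rh : r%:R <= h X by rewrite truncn_le ltW.
pose c := eta * h X * ln X ^+ (k - 1).
have c0 : 0 < c by rewrite /c mulr_gt0 ?mulr_gt0 ?exprn_gt0.
pose g n : R := if T <= (dk k n)%:R then (dk k n)%:R / T else (dk k n)%:R / c.
have g0 n : 0 <= g n by rewrite /g; case: ifP => _; rewrite divr_ge0// ltW.
set m := Num.truncn (2 * X).
(* Windows start at or below [2 * X] and have length at most [h X <= X], so they end by [3 * X]. *)
have mN : (m + r <= N)%N.
  rewrite NE truncn_ge_nat; last by lra.
  have : m%:R <= 2 * X by rewrite truncn_le; lra.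
  by rewrite natrD; lra.
have step : (exceptional_count k h eta X)%:R <= \sum_(x < m.+1) \sum_(i < r) g (i + x.+1)%N.
  rewrite /exceptional_count -sum1dep_card natr_sum big_mkcond; apply: ler_sum => x _ /=.
  case: ifP => [/and3P[Xx _ exc]|_]; last exact: sumr_ge0.
  have [/existsP[i Ti]|/existsPn noT] :=
      boolP [exists i : 'I_r, T <= (dk k (i + x.+1))%:R].
    rewrite (bigD1 i)//= {1}/g Ti; apply: (@le_trans _ _ ((dk k (i + x.+1))%:R / T)).
      by rewrite ler_pdivlMr// mul1r.
    by rewrite lerDl sumr_ge0.
  rewrite (eq_bigr (fun i : 'I_r => (dk k (i + x.+1))%:R / c)); last first.
    by move=> i _; rewrite /g (negPf (noT i)).
  rewrite -mulr_suml ler_pdivlMr// mul1r; apply: le_trans (short_sum_le k x (h X)).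
  apply: le_trans (ltW exc); rewrite /c ler_wpM2l ?mulr_ge0 ?(ltW eta0) ?(ltW h0)//.
  (* The threshold for [x] involves [ln x], which is at least the [ln X] used in [c]. *)
  rewrite lerXn2r ?nnegrE ?(ltW lnX0)//; last first.
    by rewrite ler_ln ?posrE//; lra.
  by rewrite ln_ge0//; lra.
apply: (le_trans step); apply: (le_trans (window_sum_le g m r N g0 mN)).
have G0 : 0 <= \sum_(n < N.+1) g n by exact: sumr_ge0.
apply: (le_trans (ler_wpM2r G0 rh)).
have -> : h X / T * \sum_(n < N.+1) (dk k n)%:R +
    (eta * ln X ^+ (k - 1))^-1 * \sum_(n < N.+1 | few n) (dk k n)%:R =
  h X * \sum_(n < N.+1) ((dk k n)%:R / T + (few n)%:R * ((dk k n)%:R / c)).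
  rewrite big_split /= mulrDr -mulr_suml; congr (_ + _); first by rewrite mulrAC -mulrA.
  rewrite big_mkcond !mulr_sumr; apply: eq_bigr => n _; case: ifP => _.
    rewrite mul1r /c; have := exprn_gt0 (k - 1) lnX0; move: (ln X ^+ _) => l l0.
    by field; rewrite !gt_eqF.
  by rewrite !(mul0r, mulr0).
rewrite ler_pM2l//; apply: ler_sum => n _; rewrite /g.
case: (leP T (dk k n)%:R) => dT; first by rewrite lerDl mulr_ge0// divr_ge0// ltW.
by rewrite (fewP _ dT) mul1r lerDr divr_ge0// ltW.
Qed.

End Count.

(** * Choice of [tau] and the thresholds, and conclusion *)

Theorem theorem1p2 (R : realType) (k : nat) (eps : R) (h : R -> R) :
  (2 <= k)%N -> 0 < eps ->
  (exists X0 : R, forall X : R, X0 <= X ->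
      1 <= h X /\ h X <= (ln X) `^ (k%:R * ln k%:R - k%:R + 1 - eps)) ->
  forall eta : R, 0 < eta ->
    exists X1 : R, forall X : R, X1 <= X ->
      (exceptional_count k h eta X)%:R <= eta * X.
Proof.
case: k => [|[|k]]// _ eps0 [X0 hX0] eta eta0.
set kap : R := k.+2%:R * ln k.+2%:R; set c := kap - _ + 1 - eps in hX0.
have lnk0 : 0 < ln k.+2%:R :> R by rewrite ln_gt0// ltr1n.
have kap0 : 0 < kap by rewrite mulr_gt0.
(* Lowering the exponent from [kap] to [tau * kap] spends at most half of the margin [eps]. *)
have [tau [tau0 tau1 tauE]] : exists tau : R, [/\ 0 < tau, tau < 1 & kap - eps / 2 <= tau * kap].
  have s0 : 0 < 2 * (kap + eps) by rewrite mulr_gt0 ?addr_gt0.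
  exists (1 - eps / (2 * (kap + eps))); split.
  - by rewrite subr_gt0 ltr_pdivrMr//; lra.
  - by rewrite ltrBlDr ltrDl divr_gt0.
  rewrite mulrBl mul1r lerD2l lerN2 mulrAC ler_pdivrMr//; nra.
have [L0 HL0] := sum_dk_few_primes_small k tau (eta ^+ 2 / 6)
   (introT andP (conj tau0 tau1)) (divr_gt0 (exprn_gt0 2 eta0) (ltr0Sn R 5)).
pose C : R := 6 * 2 ^+ k.+1 / eta.
pose L1 := `|L0| + 3 + (4 * c ^+ 2 + 1) + expR (2 * C / eps).
exists (`|X0| + expR L1) => X XX.
have XX0 : X0 <= X.
  have := ler_norm X0; have := expR_gt0 L1; lra.
have XL1 : expR L1 <= X by have := normr_ge0 X0; lra.
have Xp : 0 < X by apply: lt_le_trans XL1; exact: expR_gt0.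
set L := ln X.
have LL1 : L1 <= L by rewrite -ler_expR lnK.
have pe := expR_gt0 (2 * C / eps); have nL0 := normr_ge0 L0.
have nL0' := ler_norm L0; have c2 := sqr_ge0 c.
have LL0 : L0 <= L by move: LL1; rewrite /L1; lra.
have L3 : 3 <= L by move: LL1; rewrite /L1; lra.
have Lc : 4 * c ^+ 2 + 1 <= L by move: LL1; rewrite /L1; lra.
have Le : expR (2 * C / eps) <= L by move: LL1; rewrite /L1; lra.
have Lp : 0 < L by lra.
have X1 : 1 < X by rewrite -[ltLHS]expR0 -[ltRHS]lnK// ltr_expR.
have [h1 hc] := hX0 X XX0; rewrite -/L in hc.
have hX : h X <= X by apply: (le_trans hc); rewrite -[leRHS]lnK//; exact: powR_le_expR.
set T := L `^ (tau * kap).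
have T0 : 0 < T by exact: powR_gt0.
pose few n := (size (primes n))%:R < k.+2%:R * (tau * ln L).
have lnL0 : 0 < ln L by rewrite ln_gt0//; lra.
have fewP n : (dk k.+2 n)%:R < T -> few n.
  (* [0] has an empty list of primes, so [few 0] only needs a positive bound. *)
  case: n => [_|n dT]; first by rewrite /few /= !mulr_gt0.
  have : (k.+2 ^ size (primes n.+1))%:R < T.
    by apply: le_lt_trans dT; rewrite ler_nat expn_primes_leq_dk.
  (* Take logarithms and divide by [ln k.+2%:R]. *)
  rewrite natrX -ltr_ln ?posrE ?exprn_gt0// lnXn// ln_powR -[X in X < _ -> _]mulr_natl /kap /few.
  rewrite -[X in _ -> _ < X](mulfK (lt0r_neq0 lnk0)) -[X in _ -> X < _](mulfK (lt0r_neq0 lnk0)).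
  rewrite ltr_pM2r ?invr_gt0// => /lt_le_trans; apply.
  by rewrite le_eqVlt; apply/orP; left; apply/eqP; ring.
pose N := Num.truncn (3 * X).
have N3 : N%:R <= 3 * X by rewrite truncn_le; lra.
have N0 : (0 < N)%N by rewrite truncn_gt0; lra.
have HN : harm N <= 2 * L.
  apply: (le_trans (harm_le_ln N N0)).
  have : ln N%:R <= ln (3 * X) by rewrite ler_ln ?posrE ?ltr0n//; lra.
  rewrite lnM ?posrE//.
  have := @le_ln1Dx R 2; rewrite (_ : 1 + 2 = 3); last by ring.
  rewrite -/L; lra.
apply: (le_trans (exceptional_count_le k.+2 h eta X T few N eta0 X1 h1 hX T0 erefl fewP)).
rewrite -/L (_ : (k.+2 - 1)%N = k.+1)//.
have Lk0 : 0 < L ^+ k.+1 by exact: exprn_gt0.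
have t1 : h X / T * \sum_(n < N.+1) (dk k.+2 n)%:R <= eta / 2 * X.
  have hT : h X * L ^+ k.+1 * C <= T.
    apply: (@le_trans _ _ (L `^ c * L ^+ k.+1 * L `^ (eps / 2))).
      apply: ler_pM.
      - by rewrite mulr_ge0 ?(ltW Lk0)//; lra.
      - by rewrite /C divr_ge0 ?(ltW eta0)// mulr_ge0 ?exprn_ge0.
      - by rewrite ler_wpM2r ?(ltW Lk0).
      apply: le_trans (powR_ge_ln L (eps / 2) Lp).
      have : 2 * C / eps <= ln L by rewrite -ler_expR lnK.
      by rewrite ler_pdivrMr//; lra.
    rewrite -powR_mulrn ?(ltW Lp)// -!powRD ?(gt_eqF Lp) ?implybT// /T.
    (* The exponents [c], [k.+1] and [eps / 2] add up to [kap - eps / 2]. *)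
    apply: ler_powR; first lra.
    by move: tauE; rewrite /c -[k.+2%:R]natr1; lra.
  have hd : \sum_(n < N.+1) (dk k.+2 n)%:R <= N%:R * (2 ^+ k.+1 * L ^+ k.+1) :> R.
    apply: (le_trans (sum_dk_le k.+1 N)); rewrite ler_wpM2l// -exprMn.
    by rewrite lerXn2r ?nnegrE ?harm_ge0// (le_trans (harm_ge0 N)).
  have hT0 : 0 <= h X / T by rewrite divr_ge0 ?(ltW T0)//; lra.
  apply: (@le_trans _ _ (h X / T * (3 * X * (2 ^+ k.+1 * L ^+ k.+1)))).
    apply: ler_wpM2l => //; apply: (le_trans hd).
    by rewrite ler_wpM2r// mulr_ge0 ?exprn_ge0// ltW.
  have -> : h X / T * (3 * X * (2 ^+ k.+1 * L ^+ k.+1)) =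
      eta / 2 * X * ((h X * L ^+ k.+1 * C) / T).
    rewrite /C; move: (2 ^+ k.+1) (L ^+ k.+1) => a b.
    by field; rewrite !gt_eqF.
  rewrite -[leRHS]mulr1; apply: ler_wpM2l; first by rewrite mulr_ge0 ?divr_ge0 ?ltW.
  by rewrite ler_pdivrMr// mul1r.
have t2 : (eta * L ^+ k.+1)^-1 * \sum_(n < N.+1 | few n) (dk k.+2 n)%:R <= eta / 2 * X.
  have eL : 0 < eta * L ^+ k.+1 by rewrite mulr_gt0.
  rewrite mulrC ler_pdivrMr//; apply: (le_trans (HL0 L N LL0 N0 HN)).
  (* The factor [6] is [2 * 3]: [N <= 3 * X] takes the [3], leaving half of [eta * X]. *)
  apply: (@le_trans _ _ (eta ^+ 2 / 6 * (3 * X * L ^+ k.+1))).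
    rewrite ler_wpM2l ?divr_ge0 ?exprn_ge0 ?(ltW eta0)//.
    by rewrite ler_wpM2r ?(ltW Lk0).
  by move: (L ^+ k.+1) => l; lra.
lra.
Qed.
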